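(* Let $\mathcal M=(Q,A,\tau,\sigma)$ be a reversible cyclic Mealy automaton with $|A|$ prime. Suppose there is a letter $x\in A$ and constants $K>1$, $\alpha>0$ such that for all sufficiently large $n$ there is a word $w\in Q^n$ with $$\bigl|\{\boldsymbol\tau_x^k(w)\mid k\in\mathbb Z\}\bigr|\ge K^{n^\alpha}.$$ Then there is a constant $C>0$ such that for all $n$, $$\operatorname{diam}(\Gamma_{\mathcal M,n})\le C\,n^{1+1/\alpha}.$$
   Context: A Mealy automaton $\mathcal M=(Q,A,\tau,\sigma)$ consists of finite sets $Q$ (states) and $A$ (alphabet) and functions $\sigma:Q\times A\to A$ (output) and $\tau:Q\times A\to Q$ (transition); write $\sigma_q(x)=\sigma(q,x)$ and $\tau_x(q)=\tau(q,x)$. For $q\in Q$, the length-preserving map $\boldsymbol\sigma_q:A^*\to A^*$ on finite words is defined recursively by $\boldsymbol\sigma_q(\emptyset)=\emptyset$ and $\boldsymbol\sigma_q(x_0x_1\dots x_n)=y_0\,\boldsymbol\sigma_r(x_1\dots x_n)$, where $y_0=\sigma(q,x_0)$ and $r=\tau(q,x_0)$. For $x\in A$, the length-preserving map $\boldsymbol\tau_x:Q^*\to Q^*$ is defined recursively by $\boldsymbol\tau_x(\emptyset)=\emptyset$ and $\boldsymbol\tau_x(vq)=\boldsymbol\tau_y(v)\,r$ for $v\in Q^*$, $q\in Q$, where $y=\sigma(q,x)$ and $r=\tau(q,x)$. $\mathcal M$ is invertible if every $\sigma_q:A\to A$ is a bijection, and reversible if every $\tau_x:Q\to Q$ is a bijection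 (equivalently its dual automaton is invertible); in the reversible case every $\boldsymbol\tau_x$ is a bijection of $Q^*$. $\mathcal M$ is cyclic if it is invertible and the permutation group $\langle\sigma_q\mid q\in Q\rangle$ of $A$ equals $\langle (x_1\,x_2\,\dots\,x_k)\rangle$ for some enumeration $A=\{x_1,\dots,x_k\}$, $k=|A|$. For $n\in\{1,2,\dots\}$, the Schreier graph $\Gamma_{\mathcal M,n}$ of an invertible automaton is the directed graph (self-loops and repeated edges allowed) with vertex set $A^n$ and one edge $s\to\boldsymbol\sigma_q(s)$ for each $s\in A^n$ and each $q\in Q$. The distance between two vertices of a graph is the length of a shortest undirected path between them ($\infty$ if none exists), and the diameter is the maximum distance. *)

(* Defs.v *)
From HB Require Import structures.
From mathcomp Require Import all_boot all_order all_algebra all_fingroup.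
From mathcomp Require Import classical_sets reals ereal.

Set Implicit Arguments.
Unset Strict Implicit.
Unset Printing Implicit Defensive.

Import GRing.Theory.

Record mealy (Q A : finType) := Mealy {
  trans : Q -> A -> Q; (* $\tau(q, x)$ *)
  out : Q -> A -> A    (* $\sigma(q, x)$ *)
}.

Section Mealy.
Context {Q A : finType}.
Variable M : mealy Q A.

Fixpoint out_word (q : Q) (s : seq A) : seq A :=
  if s is x :: s' then out M q x :: out_word (trans M q x) s' else [::].

(* Words over [Q] are read from right to left; [trans_word_rcons] is the
   defining recursion of the action. *)
Fixpoint trans_wordr (x : A) (v : seq Q) : seq Q :=
  if v is q :: v' then trans M q x :: trans_wordr (out M q x) v' else [::].

Definition trans_word (x : A) (v : seq Q) : seq Q :=
  rev (trans_wordr x (rev v)).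

Lemma trans_word_nil x : trans_word x [::] = [::].
Proof. by []. Qed.

Lemma trans_word_rcons x v q :
  trans_word x (rcons v q) = rcons (trans_word (out M q x) v) (trans M q x).
Proof. by rewrite /trans_word rev_rcons /= rev_cons. Qed.

Lemma size_out_word q s : size (out_word q s) = size s.
Proof. by elim: s q => //= x s IHs q; rewrite IHs. Qed.

Lemma size_trans_word x v : size (trans_word x v) = size v.
Proof.
rewrite /trans_word size_rev -[RHS]size_rev.
by elim: (rev v) x => //= q u IHu x; rewrite IHu.
Qed.

Lemma out_tuple_subproof n q (s : n.-tuple A) : size (out_word q s) == n.
Proof. by rewrite size_out_word size_tuple. Qed.

Definition out_tuple n (q : Q) (s : n.-tuple A) : n.-tuple A :=
  Tuple (out_tuple_subproof q s).

Lemma trans_tuple_subproof n x (w : n.-tuple Q) : size (trans_word x w) == n.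
Proof. by rewrite size_trans_word size_tuple. Qed.

Definition trans_tuple n (x : A) (w : n.-tuple Q) : n.-tuple Q :=
  Tuple (trans_tuple_subproof x w).

Definition invertible : Prop := forall q : Q, bijective (out M q).

Definition reversible : Prop := forall x : A, bijective (trans M ^~ x).

Lemma trans_tuple_inj (Mrev : reversible) n x : injective (@trans_tuple n x).
Proof.
move=> v w /(congr1 val)/= /(can_inj revK) eq_vw.
apply/val_inj/(can_inj revK) => /=.
elim: (rev v) (rev w) x eq_vw => [|q u IHu] [|r t] x //= [eq_qr].
by rewrite (bij_inj (Mrev x) eq_qr) => /IHu->.
Qed.

Definition trans_perm (Mrev : reversible) n (x : A) : {perm n.-tuple Q} :=
  perm (@trans_tuple_inj Mrev n x).

Definition out_perm (Minv : invertible) (q : Q) : {perm A} :=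
  perm (bij_inj (Minv q)).

End Mealy.

(* The cycle $(x_1\,x_2\,\dots\,x_k)$ for distinct $x_1, \dots, x_k$. *)
Definition cycle_perm (T : finType) (xs : seq T) (Uxs : uniq xs) : {perm T} :=
  perm (can_inj (prev_next Uxs)).

Definition cyclic_mealy (Q A : finType) (M : mealy Q A) : Prop :=
  exists (Minv : invertible M) (xs : seq A) (Uxs : uniq xs),
    (forall x : A, x \in xs) /\
    (<<[set out_perm Minv q | q : Q]>> = <[cycle_perm Uxs]>)%g.

(* Directed graphs in which self-loops and repeated edges are allowed. *)
Record digraph := Digraph {
  vertex : finType;
  edge : finType;
  source : edge -> vertex;
  target : edge -> vertex
}.

Definition adjacent (G : digraph) : rel (vertex G) := fun u v =>
  [exists e : edge G, ((source e == u) && (target e == v))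
                   || ((source e == v) && (target e == u))].

(* The infimum of the empty set is [+oo], the distance between two vertices
   that no undirected path connects. *)
Definition dist (R : realType) (G : digraph) (u v : vertex G) : \bar R :=
  ereal_inf [set ((size p)%:R%:E)%R | p in
    [set p : seq (vertex G) | path (@adjacent G) u p /\ last u p = v]]%classic.

Definition diam (R : realType) (G : digraph) : \bar R :=
  ereal_sup [set dist R uv.1 uv.2 | uv in
    [set: vertex G * vertex G]]%classic.

Definition schreier (Q A : finType) (M : mealy Q A) (n : nat) : digraph :=
  @Digraph (n.-tuple A) (n.-tuple A * Q)%type
    (fun e => e.1) (fun e => out_tuple M e.2 e.1).

(* Main.v *)
Require Import Defs.
From HB Require Import structures.
From mathcomp Require Import all_boot all_order all_algebra all_fingroup.
From mathcomp Require Import cyclic boolp classical_sets reals ereal exp.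
From mathcomp Require Import ring.

Set Implicit Arguments.
Unset Strict Implicit.
Unset Printing Implicit Defensive.

Import Order.TTheory GRing.Theory Num.Theory.

(** The letter [x] and the word [x ^ n] serve as a base point of each level.
    If every word of length [n] can be brought to [x ^ n] in [d] steps, the
    diameter of level [n] is at most [2 * d]; and to pass from level [n] to
    level [n + 1] it is enough to correct the last letter while returning to
    [x ^ n] ([joined_nseq]).

    The correction uses two words [u], [v] of states of length at most [m] that
    agree on [x ^ n] but differ on [x ^ n.+1] (they are [separated]).  Running
    [u] forwards and then [v] backwards fixes [x ^ n] and acts on the next
    letter by a nontrivial element of the cyclic group generated by the
    [out M q].  Since the number of letters is prime, that element is
    transitive on letters, so fewer than [#|A|] repetitions put any letter in
    place ([joined_last_letter]).  All corrections up to level [n] together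
    cost a constant times [n * m].

    It remains to find separated words with [m] of order [n `^ (1 / alpha)].
    Suppose that no words of length at most [m] are separated at a level
    [n > 0].  The image of [x ^ n] under [u] then determines the image of
    [x ^ n.+1], hence, dropping the first letter, the image of [x ^ n] under
    the word obtained from [u] by letting [x] act.  So along the orbit of [u]
    under [x] these images form a sequence in a set of [#|A| ^ n] elements in
    which each term determines the next, and they recur after some time
    [d <= #|A| ^ n] ([label_return]).  Extending a word by one state multiplies
    its period under [x] by a divisor of [#|Q|`!], so all periods divide powers
    of [#|Q|`!], and [d] can be chosen among the divisors of the period: its
    prime factors are then at most [#|Q|].  All such [d], for all words at once,
    divide one number [smooth_lcm] that is only polynomial in [#|A| ^ n].  A last use of the factor [#|Q|`!] turns
    recurrence of the images into recurrence of the words, and every orbit of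
    [x] on words of length [m] has at most
    [(#|A| ^ n) ^ #|Q|.+1 * #|Q|`!] elements ([unseparated_porbit_le]).
    This contradicts the growth hypothesis as soon as [m `^ alpha] exceeds a
    suitable multiple of [n].

    Words of states are handled in reversed order, as lists whose head acts
    first; this is the order in which [trans_wordr] reads them. *)

(** * Return times *)

Lemma iter_fact_card (T : finType) (f : T -> T) : injective f ->
  forall t, iter (#|T|)`! f t = t.
Proof.
move=> f_inj t; pose s := perm f_inj.
have dvd_orbit : #|porbit s t| %| (#|T|)`!.
  by rewrite dvdn_fact // max_card andbT lt0n card_porbit_neq0.
have /dvdnP[k ->] := dvd_orbit.
have -> m : iter m f t = iter m s t by apply: eq_iter => v; rewrite permE.
by elim: k => // k IHk; rewrite mulSn iterD IHk iter_porbit.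
Qed.

(** Over one period the steps compose to a fixed permutation of [T], and the
    sequence sampled once per period iterates that permutation. *)
Lemma periodic_product_return (T : finType) (f : nat -> T)
    (g : nat -> T -> T) P :
    (forall k, injective (g k)) -> (forall k, g (P + k) =1 g k) ->
    (forall k, f k.+1 = g k (f k)) ->
  f (P * (#|T|)`!) = f 0.
Proof.
move=> g_inj g_per f_step.
have g_perM i k : g (i * P + k) =1 g k.
  by elim: i => // i IHi t; rewrite mulSn -addnA g_per IHi.
have f_run i k : f (i * P + k) = iteri k g (f (i * P)).
  by elim: k => [|k IHk]; rewrite ?addn0 // addnS f_step IHk g_perM.
have run_inj : injective (iteri P g).
  by elim: {+}P => // k IHk s t /g_inj/IHk.
have f_mul i : f (i * P) = iter i (iteri P g) (f 0).
  by elim: i => // i IHi; rewrite mulSnr f_run IHi.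
by rewrite mulnC f_mul iter_fact_card.
Qed.

(** Two of the first [#|B|.+1] labels coincide by pigeonhole; moving along the
    orbit until [t] is reached again turns their distance into a return time
    [d0 <= #|B|] of the label of [t].  The period [L] is another return time,
    and by Bezout so is their gcd, which is both small and a divisor of [L]. *)
Lemma label_return (T : Type) (B : finType) (f : T -> T) (lab : T -> B) L t :
    (forall i j, lab (iter i f t) = lab (iter j f t) ->
       lab (iter i.+1 f t) = lab (iter j.+1 f t)) ->
    0 < L -> iter L f t = t ->
  exists d, [/\ 0 < d, d <= #|B|, d %| L &
    forall k, lab (iter (d + k) f t) = lab (iter k f t)].
Proof.
move=> det L_gt0 ft.
have detD i j k : lab (iter i f t) = lab (iter j f t) ->
    lab (iter (k + i) f t) = lab (iter (k + j) f t).
  by move=> eq_ij; elim: k => // k /det.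
have ftM a : iter (a * L) f t = t.
  by elim: a => // a IHa; rewrite mulSn iterD IHa.
have [d0 [d0_gt0 led0 lab_d0]] : exists d0, [/\ 0 < d0, d0 <= #|B| &
    lab (iter d0 f t) = lab t].
  have /injectivePn[i [j neq_ij eq_ij]] :
      ~~ injectiveb (fun i : 'I_#|B|.+1 => lab (iter i f t)).
    by apply/injectiveP => /leq_card; rewrite card_ord ltnn.
  wlog lt_ij : i j neq_ij eq_ij / i < j.
    move=> IH; case: (ltngtP i j) => [||/val_inj eij]; first exact: IH.
      by apply: IH; rewrite 1?eq_sym.
    by rewrite eij eqxx in neq_ij.
  exists (j - i); rewrite subn_gt0 lt_ij; split=> //.
    by rewrite (leq_trans (leq_subr _ _)) // -ltnS ltn_ord.
  (* [i * L] is a multiple of the period [L] that is at least [i]. *)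
  have := detD _ _ (i * L - i) eq_ij.
  rewrite subnK ?leq_pmulr // ftM => ->.
  have -> : i * L - i + j = (j - i) + i * L.
    by rewrite addnBAC ?leq_pmulr // addnBAC 1?ltnW // addnC.
  by rewrite iterD ftM.
have lab_mul a : lab (iter (a * d0) f t) = lab t.
  elim: a => // a IHa; rewrite mulSnr.
  by rewrite (detD _ 0) // addn0.
exists (gcdn d0 L); split; rewrite ?gcdn_gt0 ?d0_gt0 ?dvdn_gcdr //.
  by rewrite (leq_trans _ led0) // dvdn_leq ?dvdn_gcdl.
move=> k; rewrite addnC; have := detD (gcdn d0 L) 0 k; rewrite addn0; apply.
case: (egcdnP L d0_gt0) => a b bez _; rewrite -[RHS](lab_mul a) bez addnC iterD.
by rewrite ftM.
Qed.

Lemma card_porbit_le (T : finType) (s : {perm T}) t k :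
  0 < k -> iter k s t = t -> #|porbit s t| <= k.
Proof.
move=> k_gt0 skt; rewrite -(size_traject s t k).
suffices sub_orbit : porbit s t \subset traject s t k.
  exact: leq_trans (subset_leq_card sub_orbit) (card_size _).
apply/fintype.subsetP.
move=> u /porbitP[i ->]; apply/trajectP; exists (i %% k); rewrite ?ltn_mod //.
rewrite permX {1}(divn_eq i k) addnC iterD; congr iter.
by elim: (i %/ k) => // a IHa; rewrite mulSn iterD IHa.
Qed.

(** * Smooth numbers *)

Lemma prime_dvd_fact r c : prime r -> r %| c`! -> r <= c.
Proof.
move=> r_pr; elim: c => [|c IHc].
  by rewrite dvdn1 (gtn_eqF (prime_gt1 r_pr)).
by rewrite factS Euclid_dvdM // => /orP[/dvdn_leq->|/IHc/leqW].
Qed.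

(** The least common multiple of the positive numbers at most [b] all of whose
    prime factors are at most [c]. *)
Definition smooth_lcm c b := \prod_(r < c.+1 | prime r) r ^ trunc_log r b.

Lemma smooth_lcm_gt0 c b : 0 < smooth_lcm c b.
Proof. by apply: prodn_gt0 => r; rewrite expn_gt0; case: (r : nat). Qed.

Lemma smooth_lcm_le c b : 0 < b -> smooth_lcm c b <= b ^ c.+1.
Proof.
move=> b_gt0; rewrite -[in leqRHS](card_ord c.+1) -prod_nat_const.
rewrite /smooth_lcm big_mkcond.
apply: leq_prod => r _; case: ifP => // /prime_gt1 r_gt1.
exact: trunc_logP.
Qed.

(** Each prime power dividing [d] is at most [b], and its prime divides
    [c`!]. *)
Lemma dvdn_smooth_lcm c b s d :
  0 < d -> d <= b -> d %| c`! ^ s -> d %| smooth_lcm c b.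
Proof.
move=> d_gt0 le_db d_dvd; apply/dvdn_partP => // r; rewrite mem_primes.
case/and3P=> r_pr _ r_dvd; rewrite p_part.
have le_rc : r < c.+1.
  have := dvdn_trans r_dvd d_dvd; rewrite Euclid_dvdX // => /andP[+ _].
  exact: prime_dvd_fact.
rewrite /smooth_lcm (bigD1 (Ordinal le_rc)) //= dvdn_mulr // dvdn_exp2l //.
rewrite trunc_log_max ?prime_gt1 // (leq_trans _ le_db) // dvdn_leq //.
exact: pfactor_dvdnn.
Qed.

(** * Orbits of words of states under a letter *)

Section Mealy.
Variables (Q A : finType) (M : mealy Q A).

Definition word_out (u : seq Q) (s : seq A) : seq A :=
  foldl (fun s q => out_word M q s) s u.

(** The letter output by the word [u] when it reads [a]; what becomes of [u]
    itself is [trans_wordr M a u]. *)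
Definition letter_out (u : seq Q) (a : A) : A :=
  foldl (fun a q => out M q a) a u.

Lemma size_word_out u s : size (word_out u s) = size s.
Proof. by elim: u s => //= q u IHu s; rewrite IHu size_out_word. Qed.

Lemma word_out_cons u a s :
  word_out u (a :: s) = letter_out u a :: word_out (trans_wordr M a u) s.
Proof. by elim: u a s => //= q u IHu a s; rewrite IHu. Qed.

Lemma size_trans_wordr a u : size (trans_wordr M a u) = size u.
Proof. by elim: u a => //= q u IHu a; rewrite IHu. Qed.

Lemma size_iter_trans_wordr k a u :
  size (iter k (trans_wordr M a) u) = size u.
Proof. by elim: k => //= k IHk; rewrite size_trans_wordr. Qed.

Lemma trans_wordr_rcons a u q :
  trans_wordr M a (rcons u q)
    = rcons (trans_wordr M a u) (trans M q (letter_out u a)).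
Proof. by elim: u a => //= r u IHu a; rewrite IHu. Qed.

Section Return.
Hypothesis Mrev : reversible M.
Variable x : A.
Local Notation turn k u := (iter k (trans_wordr M x) u).

(** The last state is moved at time [k] by the permutation attached to the
    letter that [v] outputs then, so it follows a periodic product of
    permutations. *)
Lemma turn_rcons_return P v q :
    (forall k, letter_out (turn (P + k) v) x = letter_out (turn k v) x) ->
    turn (P * (#|Q|)`!) v = v ->
  turn (P * (#|Q|)`!) (rcons v q) = rcons v q.
Proof.
move=> letter_per turn_v; pose f k := last q (turn k (rcons v q)).
have turn_rcons k : turn k (rcons v q) = rcons (turn k v) (f k).
  rewrite /f; elim: k => [|k IHk]; first by rewrite /= last_rcons.
  by rewrite /= IHk trans_wordr_rcons !last_rcons.
rewrite turn_rcons turn_v; congr rcons.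
rewrite (@periodic_product_return _ f
  (fun k => (trans M)^~ (letter_out (turn k v) x)) P) => [|k|k r|k].
- by rewrite /f /= last_rcons.
- exact: bij_inj.
- by rewrite letter_per.
by rewrite /f [turn k.+1 _]/= turn_rcons trans_wordr_rcons !last_rcons.
Qed.

(** A crude period; its use is that its prime factors are at most [#|Q|]. *)
Lemma turn_return u : turn ((#|Q|)`! ^ size u) u = u.
Proof.
elim/last_ind: u => // u q IHu; rewrite size_rcons expnSr.
have turn_per k : turn ((#|Q|)`! ^ size u + k) u = turn k u.
  by rewrite addnC iterD IHu.
have turn_mul k : turn ((#|Q|)`! ^ size u * k) u = u.
  by elim: k => [|k IHk]; rewrite ?muln0 // mulnS turn_per.
by apply: turn_rcons_return => // k; rewrite turn_per.
Qed.

(** Equivalently, running [u] and then the inverse of [v] fixes the first [n]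
    letters of [x ^ n.+1] and moves the last one. *)
Definition separated n (u v : seq Q) :=
  (word_out u (nseq n x) == word_out v (nseq n x)) &&
  (word_out u (nseq n.+1 x) != word_out v (nseq n.+1 x)).

(** Without separated words the image of [x ^ n] is a label as in
    [label_return]: the image of [x ^ n] under [turn 1 u] is the tail of the
    image of [x ^ n.+1] under [u].  The return times that this yields for the
    prefixes of [u] all divide the [smooth_lcm], which is therefore a period of the
    letters that the prefixes output. *)
Lemma unseparated_return n m :
    0 < n ->
    (forall u v, size u <= m -> size v <= m -> ~~ separated n u v) ->
  forall u, size u <= m ->
    turn (smooth_lcm #|Q| (#|A| ^ n) * (#|Q|)`!) u = u.
Proof.
move=> n_gt0 unsep; elim/last_ind => [|v q IHv].
  by move=> _; elim: (_ * _) => //= k ->.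
rewrite size_rcons => /ltnW le_vm; apply: turn_rcons_return (IHv le_vm).
have size_lab u : size (word_out u (nseq n x)) == n.
  by rewrite size_word_out size_nseq.
pose lab u : n.-tuple A := Tuple (size_lab u).
have det i j : lab (turn i v) = lab (turn j v) ->
    lab (turn i.+1 v) = lab (turn j.+1 v).
  move/(congr1 val) => /= eq_ij; apply: val_inj => /=.
  have:= unsep (turn i v) (turn j v).
  rewrite !size_iter_trans_wordr => /(_ le_vm le_vm).
  by rewrite /separated eq_ij eqxx negbK /= !word_out_cons => /eqP[].
have L_gt0 : 0 < (#|Q|)`! ^ size v by rewrite expn_gt0 fact_gt0.
have [d [d_gt0 le_d dvd_d lab_d]] := label_return det L_gt0 (turn_return v).
rewrite card_tuple in le_d.
have /dvdnP[a ->] := dvdn_smooth_lcm d_gt0 le_d dvd_d.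
have lab_ad k : lab (turn (a * d + k) v) = lab (turn k v).
  by elim: a => // a IHa; rewrite mulSn -addnA lab_d.
move=> k; have := congr1 val (lab_ad k).
by rewrite /= -(prednK n_gt0) !word_out_cons => -[].
Qed.

Lemma val_trans_perm_iter n k (w : n.-tuple Q) :
  rev (iter k (trans_perm Mrev n x) w) = turn k (rev w).
Proof.
by elim: k => //= k IHk; rewrite permE /= /trans_word revK IHk.
Qed.

Lemma unseparated_porbit_le n m (w : m.-tuple Q) :
    0 < n ->
    (forall u v, size u <= m -> size v <= m -> ~~ separated n u v) ->
  #|porbit (trans_perm Mrev m x) w|
    <= (#|A| ^ n) ^ #|Q|.+1 * (#|Q|)`!.
Proof.
move=> n_gt0 unsep.
have A_gt0 : 0 < #|A| by apply/card_gt0P; exists x.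
apply: (@leq_trans (smooth_lcm #|Q| (#|A| ^ n) * (#|Q|)`!)).
  apply: card_porbit_le; first by rewrite muln_gt0 smooth_lcm_gt0 fact_gt0.
  apply/val_inj/(can_inj revK); rewrite val_trans_perm_iter.
  by apply: unseparated_return unsep _ _; rewrite // size_rev size_tuple.
by rewrite leq_mul2r smooth_lcm_le ?orbT // expn_gt0 A_gt0.
Qed.

End Return.

(** * Walks in the Schreier graphs *)

(** Undirected walks of length at most [d].  Phrasing them on lists instead
    of tuples avoids casts when a walk is lifted from one level to the next. *)
Inductive joined : nat -> seq A -> seq A -> Prop :=
| joined_refl d s : joined d s s
| joined_out d s t q : joined d (out_word M q s) t -> joined d.+1 s t
| joined_inv d s t q : joined d s t -> joined d.+1 (out_word M q s) t.

Lemma joined_leq d d' s t : d <= d' -> joined d s t -> joined d' s t.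
Proof.
move=> le_dd' st.
elim: st d' le_dd' => {d s t} => [d s | d s t q _ IH | d s t q _ IH].
- by move=> d' _; apply: joined_refl.
- by case=> // d' /IH; apply: joined_out.
by case=> // d' /IH; apply: joined_inv.
Qed.

Lemma joined_trans d1 d2 s t r :
  joined d1 s t -> joined d2 t r -> joined (d1 + d2) s r.
Proof.
move=> st tr; elim: st tr => {d1 s t} => [d s | d s t q _ IH | d s t q _ IH] tr.
- by apply: joined_leq tr; apply: leq_addl.
- by rewrite addSn; apply: joined_out (IH tr).
by rewrite addSn; apply: joined_inv (IH tr).
Qed.

Lemma joined_sym d s t : joined d s t -> joined d t s.
Proof.
elim=> {d s t} => [d s | d s t q _ ts | d s t q _ ts].
- exact: joined_refl.
- rewrite -addn1; apply: joined_trans ts _.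
  exact/joined_inv/joined_refl.
rewrite -addn1; apply: joined_trans ts _.
exact/joined_out/joined_refl.
Qed.

Lemma joined_word_out u s : joined (size u) s (word_out u s).
Proof.
elim: u s => [|q u IHu] s /=; first exact: joined_refl.
exact/joined_out/IHu.
Qed.

Lemma out_word_rcons q s y :
  out_word M q (rcons s y)
    = rcons (out_word M q s) (out M (foldl (trans M) q s) y).
Proof. by elim: s q => //= a s IHs q; rewrite IHs. Qed.

Section Invertible.
Hypothesis Minv : invertible M.

(** Walks lift to the next level from any starting point over their source. *)
Lemma joined_rcons d s t y :
  joined d s t -> exists z, joined d (rcons s y) (rcons t z).
Proof.
move=> st; elim: st y => {d s t} => [d s | d s t q _ IH | d s t q _ IH] y.
- by exists y; apply: joined_refl.
- have [z] := IH (out M (foldl (trans M) q s) y); rewrite -out_word_rcons.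
  by move=> st_z; exists z; apply: joined_out st_z.
have [g _ gK] := Minv (foldl (trans M) q s).
have [z sz] := IH (g y); exists z.
by rewrite -(gK y) -out_word_rcons; apply: joined_inv.
Qed.

(** Once the prefix [s] is read, [u] has become another word of states, whose
    action on one letter is a product of generators. *)
Lemma word_out_rcons u s : exists2 g : {perm A},
    g \in <<[set Defs.out_perm Minv q | q : Q]>>%g &
    forall y, word_out u (rcons s y) = rcons (word_out u s) (g y).
Proof.
elim: u s => [|q u IHu] s /=; first by exists 1%g => [|y]; rewrite ?group1 ?perm1.
have [g Gg out_g] := IHu (out_word M q s).
exists (Defs.out_perm Minv (foldl (trans M) q s) * g)%g.
  by rewrite groupM // mem_gen // imset_f.
by move=> y; rewrite out_word_rcons out_g permM permE.
Qed.

End Invertible.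

Lemma joined_path n d (s t : n.-tuple A) : joined d s t ->
  exists p, [/\ path (@adjacent (schreier M n)) s p, last s p = t & size p <= d].
Proof.
move: {2}(val s) {2}(val t) (erefl (val s)) (erefl (val t)) => s' t' es et.
rewrite es et => st.
elim: st s t es et => {d s' t'} [d s' | d s' t' q _ IH | d s' t' q _ IH] s t es et.
- by exists [::]; split=> //; apply: val_inj; rewrite /= es et.
- have [||p [p_path p_last p_size]] := IH (out_tuple M q s) t; rewrite /= ?es //.
  exists (out_tuple M q s :: p); split=> //=; rewrite p_path andbT.
  by apply/existsP; exists (s, q); rewrite /= !eqxx.
have s'_size : size s' == n by rewrite -(size_out_word M q) -es size_tuple.
have [||p [p_path p_last p_size]] := IH (Tuple s'_size) t => //.
exists (Tuple s'_size :: p); split=> //=; rewrite p_path andbT.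
apply/existsP; exists (Tuple s'_size, q); rewrite /= eqxx /= orbC.
by apply/orP; left; apply/eqP/val_inj; rewrite es.
Qed.

End Mealy.

(** * Transitivity in prime degree *)

Lemma cycle_perm_porbit (T : finType) (xs : seq T) (Uxs : uniq xs) a b :
  (forall c, c \in xs) -> b \in porbit (cycle_perm Uxs) a.
Proof.
move=> xsT; apply/porbitP.
have /iter_findex <- : fconnect (next xs) a b.
  by rewrite (fconnect_cycle (cycle_next Uxs)).
exists (findex (next xs) a b); rewrite permX.
by apply: eq_iter => c; rewrite permE.
Qed.

(** A transitive [c] has order dividing [#|T|]; a nontrivial [h] then has order
    exactly [#|T|] and generates the same group as [c]. *)
Lemma prime_cycle_transitive (T : finType) (c h : {perm T}) a b :
    prime #|T| -> (forall a b, b \in porbit c a) ->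
    h \in <[c]>%g -> h != 1%g ->
  exists2 i, i < #|T| & (h ^+ i)%g a = b.
Proof.
move=> T_pr c_trans ch h_neq1.
have ord_c : #[c]%g %| #|T|.
  rewrite order_dvdn; apply/eqP/permP => t; rewrite perm1 permX.
  have -> : #|T| = #|porbit c t|.
    by apply: eq_card => t'; rewrite c_trans.
  exact: iter_porbit.
have ord_h : #[h]%g = #|T|.
  apply/(prime_nt_dvdP T_pr); first by rewrite order_eq1.
  by apply: dvdn_trans ord_c; apply: order_dvdG.
have eq_hc : (<[h]> = <[c]>)%g.
  apply/eqP; rewrite eqEcard cycle_subG ch -!orderE ord_h dvdn_leq //.
  by rewrite prime_gt0.
have /porbitP[i ->] := c_trans a b.
have /cyclePmin[j lt_j eq_j] : (c ^+ i)%g \in <[h]>%g by rewrite eq_hc mem_cycle.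
by exists j; rewrite ?eq_j -?ord_h.
Qed.

(** * Bringing words to the base point *)

Section Cyclic.
Variables (Q A : finType) (M : mealy Q A) (x : A).
Hypotheses (Mcyc : cyclic_mealy M) (A_prime : prime #|A|).

Lemma joined_last_letter n m u v y :
    size u <= m -> size v <= m -> separated M x n u v ->
  joined M (#|A| * m.*2) (rcons (nseq n x) y) (nseq n.+1 x).
Proof.
case: Mcyc => Minv [xs [Uxs [xsT Gcyc]]] le_u le_v.
have nseqSr : nseq n.+1 x = rcons (nseq n x) x.
  by rewrite -cats1 -[[:: x]]/(nseq 1 x) -nseqD addn1.
rewrite /separated nseqSr => /andP[/eqP uv_n].
have [g Gg out_u] := word_out_rcons Minv u (nseq n x).
have [h Gh out_v] := word_out_rcons Minv v (nseq n x).
rewrite out_u out_v uv_n => neq_gh.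
(* The walk along [u] and back along [v] fixes [x ^ n] and moves the last
   letter by [g * h^-1], which is not the identity since it moves [x]. *)
have step z : joined M m.*2 (rcons (nseq n x) z)
                (rcons (nseq n x) ((g * h^-1)%g z)).
  rewrite -addnn; apply: (@joined_trans _ _ _ _ _ _
                            (word_out M u (rcons (nseq n x) z))).
    exact: (joined_leq le_u (joined_word_out M u _)).
  rewrite out_u uv_n.
  have -> : g z = h ((g * h^-1)%g z) by rewrite permM permKV.
  by rewrite -out_v; apply/joined_sym/(joined_leq le_v (joined_word_out M v _)).
have steps i z : joined M (i * m.*2) (rcons (nseq n x) z)
                   (rcons (nseq n x) (((g * h^-1) ^+ i)%g z)).
  elim: i => [|i IHi]; first by rewrite perm1; apply: joined_refl.
  by rewrite mulSnr expgSr permM; apply: joined_trans IHi (step _).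
have [] := @prime_cycle_transitive A (cycle_perm Uxs) (g * h^-1)%g y x A_prime.
- by move=> a b; apply: cycle_perm_porbit.
- by rewrite -Gcyc groupM ?groupV.
- by apply: contra_neq neq_gh => /eqP; rewrite -eq_mulgV1 => /eqP->.
move=> i lt_i eq_x; have := steps i y; rewrite eq_x; apply: joined_leq.
by rewrite leq_mul2r ltnW ?orbT.
Qed.

(** Induction on the length: bring the prefix to the base point, then correct
    the last letter. *)
Lemma joined_nseq n m s :
    (forall k, k < n -> exists u v,
       [/\ size u <= m, size v <= m & separated M x k u v]) ->
    size s <= n ->
  joined M (size s * (#|A| * m.*2)) s (nseq (size s) x).
Proof.
have [Minv _] := Mcyc.
move=> sep; elim/last_ind: s => [|s y IHs]; first by move=> _; apply: joined_refl.
rewrite size_rcons => lt_sn; have [z sz] := joined_rcons Minv y (IHs (ltnW lt_sn)).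
have [u [v [le_u le_v sep_uv]]] := sep _ lt_sn.
by rewrite mulSnr; apply: joined_trans sz (joined_last_letter _ le_u le_v sep_uv).
Qed.

(** At level [0] the empty word is separated from any state that moves [x]; if
    there were none, the whole group would fix [x] and not be transitive. *)
Lemma separated0 : exists q, separated M x 0 [::] [:: q].
Proof.
case: Mcyc => Minv [xs [Uxs [xsT Gcyc]]].
have [/existsP[q out_q]|] := boolP [exists q, out M q x != x].
  by exists q; rewrite /separated /= eqseq_cons eq_sym (negPf out_q).
rewrite negb_exists => /forallP fix_x.
have [a [b [_ _ neq_ab]]] := card_gt1P (prime_gt1 A_prime).
have fixG : (<[cycle_perm Uxs]>)%g \subset 'C[x | 'P]%g.
  rewrite -Gcyc gen_subG; apply/fintype.subsetP => _ /imsetP[q _ ->].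
  by apply/astab1P; rewrite /= apermE permE; apply/eqP; have := fix_x q; rewrite negbK.
have all_x y : y = x.
  have /porbitP[i ->] := cycle_perm_porbit Uxs x y xsT.
  by have /(fintype.subsetP fixG)/astab1P := mem_cycle (cycle_perm Uxs) i.
by rewrite (all_x a) (all_x b) eqxx in neq_ab.
Qed.

(** Level [0] is [separated0]; the other levels are the contrapositive of
    [unseparated_porbit_le], with one bound that serves all [k < n]. *)
Lemma separated_below (Mrev : reversible M) n m (w : m.-tuple Q) : 0 < m ->
    (#|A| ^ #|Q|.+1 * (#|Q|)`!) ^ n < #|porbit (trans_perm Mrev m x) w| ->
  forall k, k < n -> exists u v,
    [/\ size u <= m, size v <= m & separated M x k u v].
Proof.
move=> m_gt0 orbit_gt [_|k lt_kn].
  by have [q sep_q] := separated0; exists [::], [:: q].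
apply: contrapT => nosep; move: orbit_gt; rewrite ltnNge => /negP; apply.
apply: leq_trans (unseparated_porbit_le Mrev w (ltn0Sn k) _) _.
  by move=> u v le_u le_v; apply/negP => sep_uv; apply: nosep; exists u, v.
have A_gt0 := prime_gt0 A_prime.
rewrite expnMn -expnM -expnM leq_mul //.
  by rewrite leq_pexp2l // mulnC leq_mul2l ltnW ?orbT.
by rewrite -[leqLHS]expn1 leq_pexp2l ?fact_gt0 // (leq_ltn_trans _ lt_kn).
Qed.

End Cyclic.

Local Open Scope ring_scope.

(** * Diameter bound *)

Lemma diam_schreier_le (R : realType) (Q A : finType) (M : mealy Q A) x n d :
    (forall s : n.-tuple A, joined M d s (nseq n x)) ->
  (diam R (schreier M n) <= (d.*2)%:R%:E)%E.
Proof.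
move=> to_x; apply: ge_ereal_sup => _ [[s t] _ <-].
have st : joined M d.*2 s t.
  by rewrite -addnn; apply: joined_trans (to_x s) (joined_sym (to_x t)).
have [p [p_path p_last p_size]] := joined_path st.
apply: ge_ereal_inf; exists (size p)%:R%:E; first by exists p.
by rewrite lee_fin ler_nat.
Qed.

(** The bound on [m] solves [K `^ (m `^ alpha) = X ^+ n] for [m]. *)
Lemma powR_gt_exprn (R : realType) (K alpha m X : R) (n : nat) :
    1 < K -> 0 < alpha -> 1 <= X ->
    (n%:R * (ln X / ln K)) `^ (1 / alpha) < m ->
  X ^+ n < K `^ (m `^ alpha).
Proof.
move=> K_gt1 alpha_gt0 X_ge1 m_gt.
have K_gt0 : 0 < K by apply: lt_trans K_gt1.
have X_gt0 : 0 < X by apply: lt_le_trans X_ge1.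
have lnK_gt0 : 0 < ln K by apply: ln_gt0.
have lnX_ge0 : 0 <= ln X by apply: ln_ge0.
have c_ge0 : 0 <= n%:R * (ln X / ln K) by rewrite mulr_ge0 // divr_ge0 // ltW.
have lt_pow : n%:R * (ln X / ln K) < m `^ alpha.
  have := gt0_ltr_powR alpha_gt0 _ _ m_gt.
  rewrite -powRrM div1r mulVf ?gt_eqF // powRr1 // !nnegrE; apply.
    exact: powR_ge0.
  exact/ltW/(le_lt_trans _ m_gt)/powR_ge0.
rewrite /powR gt_eqF // -[in ltLHS](lnK X_gt0) -expRM_natl ltr_expR.
by rewrite -ltr_pdivrMr // -mulrA.
Qed.

Theorem theorem8p3 (R : realType) (Q A : finType) (M : mealy Q A)
    (Mrev : reversible M) (Mcyc : cyclic_mealy M) (A_prime : prime #|A|)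
    (x : A) (K alpha : R) (K_gt1 : 1 < K) (alpha_gt0 : 0 < alpha)
    (growth : exists N : nat, forall n : nat, (N <= n)%N ->
       exists w : n.-tuple Q,
         K `^ (n%:R `^ alpha) <= #|porbit (trans_perm Mrev n x) w|%:R) :
  exists2 C : R, 0 < C &
    forall n : nat, (0 < n)%N ->
      (diam R (schreier M n) <= (C * n%:R `^ (1 + 1 / alpha))%:E)%E.
Proof.
have A_gt0 := prime_gt0 A_prime; have [N grow] := growth.
(* [X ^ n] bounds the orbits under [x] when some level [k] with [0 < k < n]
   has no separated words. *)
pose X := (#|A| ^ #|Q|.+1 * (#|Q|)`!)%N; pose c : R := ln X%:R / ln K.
have X_ge1 : 1 <= X%:R :> R by rewrite ler1n muln_gt0 expn_gt0 A_gt0 fact_gt0.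
have c_ge0 : 0 <= c by rewrite divr_ge0 ?ln_ge0 // ltW.
pose C1 := N.+1%:R + c `^ (1 / alpha).
have C1_gt0 : 0 < C1 by rewrite ltr_pwDl ?ltr0Sn ?powR_ge0.
exists (4 * #|A|%:R * C1) => [|n n_gt0].
  by rewrite !mulr_gt0 ?ltr0n.
pose b := (n%:R * c) `^ (1 / alpha).
(* The summand [N] makes the growth hypothesis apply to length [m]. *)
pose m := (N + (Num.trunc b).+1)%N.
have b_lt_m : b < m%:R.
  by apply: lt_le_trans (truncnS_gt b) _; rewrite ler_nat leq_addl.
have m_le : m%:R <= C1 * n%:R `^ (1 / alpha).
  have n_ge1 : 1 <= n%:R `^ (1 / alpha) :> R.
    by rewrite -[leLHS](powRr0 n%:R) ler_powR ?ler1n // ltW // divr_gt0.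
  rewrite /C1 mulrDl /m -addSnnS natrD lerD //.
    by rewrite ler_peMr.
  by rewrite -powRM ?(mulrC c) // truncn_le powR_ge0.
have [w w_orbit] := grow m (leq_addr _ _).
have sep : forall k, (k < n)%N -> exists u v,
    [/\ (size u <= m)%N, (size v <= m)%N & separated M x k u v].
  apply: (@separated_below _ _ _ _ Mcyc A_prime Mrev n m w).
    by rewrite /m addnS.
  rewrite -(ltr_nat R) natrX; apply: lt_le_trans w_orbit.
  exact: powR_gt_exprn.
have to_x (s : n.-tuple A) : joined M (n * (#|A| * m.*2)) s (nseq n x).
  by have := joined_nseq Mcyc A_prime sep (s := s); rewrite size_tuple; apply.
apply: le_trans (diam_schreier_le R to_x) _; rewrite lee_fin.
rewrite powRD; last by rewrite pnatr_eq0 -lt0n n_gt0 implybT.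
rewrite powRr1 //.
have -> : ((n * (#|A| * m.*2)).*2%:R : R) = 4 * #|A|%:R * n%:R * m%:R.
  rewrite -!mul2n !natrM; ring.
rewrite -!mulrA ler_wpM2l // ler_wpM2l // [leRHS]mulrCA ler_wpM2l //.
Qed.
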